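(* Let $P$ be a set of $n$ points in the plane, each with a real weight, and suppose $\mathrm{diam}(P)$ is bounded by a constant (i.e., $\mathrm{diam}(P)=O(1)$). Then there is an algorithm running in $O(n)$ time on the real-RAM that computes an independent set $I^*\subseteq P$ of the unit disk graph of $P$ with $4\,w(I^* )\geq w(\mathit{OPT})$, where $\mathit{OPT}$ is a maximum-weight independent set of that unit disk graph (i.e., it $4$-approximates the maximum-weight independent set problem).
   Context: The unit disk graph (UDG) of a point set $P\subset\mathbb{R}^2$ has vertex set $P$, and two points are adjacent iff their Euclidean distance is at most $2$ (they are centers of intersecting unit disks). A set of points is independent if the minimum pairwise distance among them is strictly greater than $2$. For a point $p$, $w(p)$ is its weight, and $w(S)=\sum_{p\in S}w(p)$. The maximum-weight independent set problem (WIS) asks for an independent subset of maximum total weight. $\mathrm{diam}(P)$ is the maximum Euclidean distance between two points of $P$. *)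

(* Defs.v *)
From HB Require Import structures.
From mathcomp Require Import all_boot all_order all_algebra.
From mathcomp Require Import reals.

Set Implicit Arguments.
Unset Strict Implicit.
Unset Printing Implicit Defensive.

Import Order.TTheory GRing.Theory Num.Theory.
Local Open Scope ring_scope.

(* A set of n weighted points is given by an injective
   [P : 'I_n -> R * R] and [w : 'I_n -> R]; a subset of it is a set of indices. *)

Section UnitDiskGraph.
Variables (R : realType) (n : nat).
Implicit Types (P : 'I_n -> R * R) (w : 'I_n -> R) (S : {set 'I_n}).

(* The library norm on [R * R] is the max norm, hence the explicit formula. *)
Definition dist (p q : R * R) : R :=
  Num.sqrt ((p.1 - q.1) ^+ 2 + (p.2 - q.2) ^+ 2).

(* The default value 0 only matters for n = 0, as dist p p = 0. *)
Definition diam P : R :=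
  \big[Num.max/0]_(i < n) \big[Num.max/0]_(j < n) dist (P i) (P j).

Definition udg P : rel 'I_n := fun i j => (i != j) && (dist (P i) (P j) <= 2).

Definition independent P S : Prop :=
  forall i j, i \in S -> j \in S -> i != j -> 2 < dist (P i) (P j).

Lemma independent_udg P S :
  independent P S <-> forall i j, i \in S -> j \in S -> ~~ udg P i j.
Proof.
rewrite /udg; split=> indS i j iS jS.
  by rewrite negb_and negbK -ltNge; case: eqVneq => //= ij; apply: indS.
by move=> ij; move: (indS i j iS jS); rewrite ij /= -ltNge.
Qed.

Definition weight w S : R := \sum_(i in S) w i.

Definition max_weight_independent P w S : Prop :=
  independent P S /\ forall S', independent P S' -> weight w S' <= weight w S.

End UnitDiskGraph.

(* A load/store real RAM.  It has word registers and real registers, addressed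
   by the constants in the program (so that a program uses only finitely many
   of them), and a word memory and a real memory, addressed indirectly through
   word registers.  Every instruction has unit cost.  The only operations on
   reals are field operations, comparisons, integer constants and the
   conversion of words to reals: there is no rounding, so reals never flow into
   words except through comparisons.  In each constructor with a destination
   register, that register comes first; jumps are to absolute addresses. *)
Inductive instr : Type :=
| WConst of nat & nat
| WMove of nat & nat
| WAdd of nat & nat & nat
| WSub of nat & nat & nat
| WMul of nat & nat & nat
| WDiv of nat & nat & nat
| WLoad of nat & nat               (* WLoad d a: wreg d <- wmem (wreg a) *)
| WStore of nat & nat              (* WStore a s: wmem (wreg a) <- wreg s *)
| RConst of nat & int
| RMove of nat & nat
| ROfWord of nat & nat             (* ROfWord d s: rreg d <- (wreg s)%:R *)
| RAdd of nat & nat & nat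
| RSub of nat & nat & nat
| RMul of nat & nat & nat
| RDiv of nat & nat & nat
| RLoad of nat & nat               (* RLoad d a: rreg d <- rmem (wreg a) *)
| RStore of nat & nat              (* RStore a s: rmem (wreg a) <- rreg s *)
| Jump of nat
| JumpWEq of nat & nat & nat       (* JumpWEq a b l: if wreg a = wreg b goto l *)
| JumpWLt of nat & nat & nat
| JumpREq of nat & nat & nat
| JumpRLt of nat & nat & nat
| Halt.

Definition program := seq instr.

Section RealRAM.
Variable R : realType.

Record config : Type := Config {
  pc : nat;
  wreg : nat -> nat;
  rreg : nat -> R;
  wmem : nat -> nat;
  rmem : nat -> R
}.

(* [W] is the largest integer that fits in a word.  Writing a larger value in a
   word register is a fault, as are division by zero, in words or in reals, and
   leaving the program; a faulty computation, represented by [None], has no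
   result.  [WSub] is truncated subtraction. *)
Variable W : nat.

Definition set_wreg (c : config) (d v : nat) : option config :=
  if (v <= W)%N then
    Some (Config (pc c).+1 [eta wreg c with d |-> v] (rreg c) (wmem c) (rmem c))
  else None.

Definition set_rreg (c : config) (d : nat) (v : R) : option config :=
  Some (Config (pc c).+1 (wreg c) [eta rreg c with d |-> v] (wmem c) (rmem c)).

Definition set_wmem (c : config) (a v : nat) : option config :=
  Some (Config (pc c).+1 (wreg c) (rreg c) [eta wmem c with a |-> v] (rmem c)).

Definition set_rmem (c : config) (a : nat) (v : R) : option config :=
  Some (Config (pc c).+1 (wreg c) (rreg c) (wmem c) [eta rmem c with a |-> v]).

Definition jump_if (b : bool) (c : config) (l : nat) : option config :=
  Some (Config (if b then l else (pc c).+1)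
               (wreg c) (rreg c) (wmem c) (rmem c)).

Definition exec (i : instr) (c : config) : option config :=
  match i with
  | WConst d k => set_wreg c d k
  | WMove d a => set_wreg c d (wreg c a)
  | WAdd d a b => set_wreg c d (wreg c a + wreg c b)%N
  | WSub d a b => set_wreg c d (wreg c a - wreg c b)%N
  | WMul d a b => set_wreg c d (wreg c a * wreg c b)%N
  | WDiv d a b =>
      if wreg c b == 0%N then None else set_wreg c d (wreg c a %/ wreg c b)%N
  | WLoad d a => set_wreg c d (wmem c (wreg c a))
  | WStore a s => set_wmem c (wreg c a) (wreg c s)
  | RConst d z => set_rreg c d z%:~R
  | RMove d a => set_rreg c d (rreg c a)
  | ROfWord d s => set_rreg c d (wreg c s)%:R
  | RAdd d a b => set_rreg c d (rreg c a + rreg c b)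
  | RSub d a b => set_rreg c d (rreg c a - rreg c b)
  | RMul d a b => set_rreg c d (rreg c a * rreg c b)
  | RDiv d a b =>
      if rreg c b == 0 then None else set_rreg c d (rreg c a / rreg c b)
  | RLoad d a => set_rreg c d (rmem c (wreg c a))
  | RStore a s => set_rmem c (wreg c a) (rreg c s)
  | Jump l => jump_if true c l
  | JumpWEq a b l => jump_if (wreg c a == wreg c b) c l
  | JumpWLt a b l => jump_if (wreg c a < wreg c b)%N c l
  | JumpREq a b l => jump_if (rreg c a == rreg c b) c l
  | JumpRLt a b l => jump_if (rreg c a < rreg c b) c l
  | Halt => None
  end.

Definition step (prog : program) (c : config) : option config :=
  obind (exec^~ c) (onth prog (pc c)).

Definition run (prog : program) (t : nat) (c : config) : option config :=
  iter t (obind (step prog)) (Some c).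

Definition halts_within (prog : program) (T : nat) (c c' : config) : Prop :=
  exists t, [/\ (t <= T)%N, run prog t c = Some c'
              & onth prog (pc c') = Some Halt].

End RealRAM.

Section InputOutput.
Variables (R : realType) (n : nat).

(* The input is n in word register 0 and, for each i < n, the coordinates and
   the weight of point i in real memory cells 3i, 3i+1 and 3i+2. *)
Definition input_rmem (P : 'I_n -> R * R) (w : 'I_n -> R) (a : nat) : R :=
  if insub (a %/ 3)%N is Some i
  then nth 0 [:: (P i).1; (P i).2; w i] (a %% 3)%N else 0.

Definition input_config (P : 'I_n -> R * R) (w : 'I_n -> R) : config R :=
  Config 0 [eta (fun _ => 0%N) with 0%N |-> n] (fun _ => 0)
         (fun _ => 0%N) (input_rmem P w).

(* The output is the set marked by nonzero entries in the first n word memory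
   cells. *)
Definition output_set (c : config R) : {set 'I_n} :=
  [set i : 'I_n | wmem c i != 0%N].

End InputOutput.
Arguments output_set {R} n c.

(* Main.v *)
Require Import Defs.
From HB Require Import structures.
From mathcomp Require Import all_boot all_order all_algebra.
From mathcomp Require Import reals.
From mathcomp Require Import ring lra zify.

Set Implicit Arguments.
Unset Strict Implicit.
Unset Printing Implicit Defensive.

Import Order.TTheory GRing.Theory Num.Theory.
Local Open Scope ring_scope.

(* Overlay a grid of side 1/m around point 0, where m depends only on D, and let
   the representative of a cell be a heaviest point in it.  There are O(1) cells,
   so the representatives take one pass over the points per cell, and a heaviest
   independent set of representatives is found by trying all sets of cells.

   Moving an independent set S to the representatives of its cells does not
   decrease its weight and leaves all distances at least 2 - O(1/m).  In such a
   nearly independent set of diameter at most D, the point farthest from point 0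
   has at most three others within distance 2: as seen from it, two such points
   are at an angle of at least nearly 60 degrees, so four would span nearly 180
   degrees, whereas they lie in a cone whose angle is less than 180 degrees by a
   margin depending only on D.  So the graph "at distance at most 2" on the moved
   points is 3-degenerate, hence 4-colourable, and the heaviest colour class is an
   independent set of representatives of weight at least w(S) / 4. *)

(** * Vectors nearly 60 degrees apart *)

Section PlaneVectors.
Variable R : realFieldType.
Implicit Types (a b c d u : R * R) (e : R).

Definition dot a b : R := a.1 * b.1 + a.2 * b.2.
Definition cross a b : R := a.1 * b.2 - a.2 * b.1.
Definition sqdist a b : R := (a.1 - b.1) ^+ 2 + (a.2 - b.2) ^+ 2.

Lemma sqdistC a b : sqdist a b = sqdist b a.
Proof. by rewrite /sqdist; ring. Qed.

(** Parallel vectors on the same side of [u] would have [dot a b] equal to the product of their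
    lengths, at least [4 - e], which exceeds [2 + e / 2]. *)
Lemma cross_neq0 e u a b : e <= 2^-1 ->
  1 <= dot a u -> 1 <= dot b u -> 4 - e <= dot a a -> 4 - e <= dot b b ->
  dot a b <= 2 + e / 2 -> cross a b != 0.
Proof.
move=> e_le au bu aa bb ab; apply/eqP => ab0.
have lagrange : dot a b ^+ 2 = dot a a * dot b b - cross a b ^+ 2.
  by rewrite /dot /cross; ring.
have proj : dot a a * dot b u = dot a b * dot a u
    + cross a b * (a.1 * u.2 - a.2 * u.1).
  by rewrite /dot /cross; ring.
rewrite ab0 in lagrange proj.
have ab_pos : 0 < dot a b.
  have : 0 < dot a b * dot a u.
    have : 0 < dot a a * dot b u by apply: mulr_gt0; lra.
    by rewrite proj mul0r addr0.
  by rewrite pmulr_lgt0 //; lra.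
have : (4 - e) * (4 - e) <= dot a a * dot b b by apply: ler_pM => //; lra.
have : dot a b ^+ 2 <= (2 + e / 2) ^+ 2 by apply: lerXn2r; rewrite ?nnegrE; lra.
by rewrite lagrange; nra.
Qed.

(* Expanding [cross a c *: b = cross b c *: a + cross a b *: c] against [b] and
   against [a + c] bounds [cross a c] by about half of [cross a b + cross b c],
   and then [dot a c]. *)
Lemma dot_outer_le e t a b c : 0 <= e -> e <= 2^-1 -> 0 <= t ->
  4 - e <= dot a a -> 4 - e <= dot b b -> 4 - e <= dot c c ->
  dot a b <= 2 + e / 2 -> dot b c <= 2 + e / 2 -> dot a b + dot b c <= t ->
  0 < cross a b -> 0 <= cross b c -> 0 <= cross a c ->
  dot a c <= - 4 + e + (2^-1 + e / 3) * t.
Proof.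
move=> e0 e1 t0 aa bb cc ab bc abc q0 p0 x0.
have dot_b : cross a c * dot b b = cross b c * dot a b + cross a b * dot b c.
  by rewrite /dot /cross; ring.
have dot_ac : cross a c * (dot a b + dot b c) =
    cross b c * (dot a a + dot a c) + cross a b * (dot c c + dot a c).
  by rewrite /dot /cross; ring.
set x := cross a c in x0 dot_b dot_ac.
set p := cross b c in p0 dot_b dot_ac.
set q := cross a b in q0 dot_b dot_ac.
have pq0 : 0 < p + q by lra.
have x_le : x <= (2^-1 + e / 3) * (p + q).
  have h1 : x * (4 - e) <= x * dot b b by apply: ler_wpM2l.
  have h2 : p * dot a b <= p * (2 + e / 2) by apply: ler_wpM2l.
  have h3 : q * dot b c <= q * (2 + e / 2) by apply: ler_wpM2l => //; lra.
  (* For [e] between 0 and 1, [2^-1 + e / 3] is at least [(2 + e / 2) / (4 - e)]. *)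
  have h4 : (2 + e / 2) * (p + q) <= (2^-1 + e / 3) * (4 - e) * (p + q).
    by apply: ler_wpM2r; [lra | nra].
  have : x * (4 - e) <= (2^-1 + e / 3) * (p + q) * (4 - e) by lra.
  by rewrite ler_pM2r //; lra.
have h1 : x * (dot a b + dot b c) <= x * t by apply: ler_wpM2l.
have h2 : x * t <= (2^-1 + e / 3) * (p + q) * t by apply: ler_wpM2r.
have h3 : p * (4 - e + dot a c) <= p * (dot a a + dot a c).
  by apply: ler_wpM2l => //; lra.
have h4 : q * (4 - e + dot a c) <= q * (dot c c + dot a c).
  by apply: ler_wpM2l; lra.
have : (4 - e + dot a c) * (p + q) <= (2^-1 + e / 3) * t * (p + q) by lra.
by rewrite ler_pM2r // => ?; lra.
Qed.

(** Angles add up: [b] and [d] are at nearly 120 degrees or more, so [a] and [d] are nearly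
    opposite. Then [a + d] is short but has inner product at least 2 with [u], against
    Cauchy-Schwarz. *)
Lemma sorted_vectors_contra e B u a b c d :
  0 < e -> e <= 2^-1 -> 2 * e * B < 1 -> dot u u <= B ->
  (forall v, v \in [:: a; b; c; d] -> 4 - e <= dot v v <= 4 /\ 1 <= dot v u) ->
  dot a b <= 2 + e / 2 -> dot b c <= 2 + e / 2 -> dot c d <= 2 + e / 2 ->
  0 <= cross a b -> 0 <= cross b c -> 0 <= cross c d ->
  0 <= cross a c -> 0 <= cross b d -> 0 <= cross a d -> False.
Proof.
move=> e0 e1 eB uB Hv ab bc cd Xab Xbc Xcd Xac Xbd Xad.
have [/andP[aa aa4] au] : _ /\ _ := Hv a ltac:(by rewrite !inE eqxx).
have [/andP[bb _] bu] : _ /\ _ := Hv b ltac:(by rewrite !inE eqxx !orbT).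
have [/andP[cc _] cu] : _ /\ _ := Hv c ltac:(by rewrite !inE eqxx !orbT).
have [/andP[dd dd4] du] : _ /\ _ := Hv d ltac:(by rewrite !inE eqxx !orbT).
have Pab : 0 < cross a b by rewrite lt0r Xab andbT (@cross_neq0 e u).
have Pbc : 0 < cross b c by rewrite lt0r Xbc andbT (@cross_neq0 e u).
have e0' := ltW e0.
have bd : dot b d <= - 2 + 3 * e.
  have := @dot_outer_le e (4 + e) b c d e0' e1 ltac:(lra) bb cc dd bc cd
    ltac:(lra) Pbc Xcd Xbd.
  by nra.
(* [7 / 2 * e] is the sum of the bounds [2 + e / 2] on [dot a b] and [- 2 + 3 * e] on [dot b d]. *)
have ad : dot a d <= - 4 + 4 * e.
  have := @dot_outer_le e (7 / 2 * e) a b d e0' e1 ltac:(lra) aa bb dd ab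
    ltac:(lra) ltac:(lra) Pab Xbd Xad.
  by nra.
pose s := (a.1 + d.1, a.2 + d.2).
have su : 2 <= dot s u by move: au du; rewrite /dot /=; lra.
have ss : dot s s <= 8 * e.
  have -> : dot s s = dot a a + dot d d + 2 * dot a d by rewrite /dot /=; ring.
  lra.
have cs : dot s u ^+ 2 <= dot s s * dot u u.
  have -> : dot s s * dot u u = dot s u ^+ 2 + cross s u ^+ 2.
    by rewrite /dot /cross; ring.
  by rewrite lerDl sqr_ge0.
have uu0 : 0 <= dot u u by rewrite /dot; nra.
have h : dot s s * dot u u <= 8 * e * B.
  by apply: ler_pM => //; rewrite /dot; nra.
(* Now [4 <= dot s u ^+ 2 <= 8 * e * B < 4]. *)
by nra.
Qed.

(** All vectors lie in an open half plane, where sorting by slope sorts by angle. The bounds on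
    inner products follow from lengths at most 2 and distances nearly 2 or more by the law of
    cosines. *)
Lemma no_four_vectors e B u (I : eqType) (s : seq I) (v : I -> R * R) :
  0 < e -> e <= 2^-1 -> 2 * e * B < 1 -> dot u u <= B -> uniq s ->
  (forall i, i \in s -> 4 - e <= dot (v i) (v i) <= 4 /\ 1 <= dot (v i) u) ->
  {in s &, forall i j, i != j -> 4 - e <= sqdist (v i) (v j)} ->
  (size s <= 3)%N.
Proof.
move=> e0 e1 eB uB us Hv Hd; rewrite leqNgt; apply/negP => s4.
(* The tangent of the signed angle from [u] to [v i]. *)
pose slope i := cross u (v i) / dot (v i) u.
pose r i j := slope i <= slope j.
pose z := sort r s.
have mz : z =i s by exact: mem_sort.
have uz : uniq z by rewrite sort_uniq.
have sz : sorted r z by apply: sort_sorted => i j; exact: le_total.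
have : (3 < size z)%N by rewrite size_sort.
move: z mz uz sz => [|i [|j [|k [|l z]]]] //= mz uz /and4P[ij jk kl _] _.
have si : i \in s by rewrite -mz !inE eqxx.
have sj : j \in s by rewrite -mz !inE eqxx !orbT.
have sk : k \in s by rewrite -mz !inE eqxx !orbT.
have sl : l \in s by rewrite -mz !inE eqxx !orbT.
move: uz; rewrite !inE !negb_or -!andbA.
case/and5P=> nij nik nil _ /and5P[njk njl _ nkl _].
have uu : 0 < dot u u.
  rewrite lt0r; apply/andP; split; last by rewrite /dot; nra.
  apply: contraTneq (Hv i si).2 => uu0.
  have [u1 u2] : u.1 = 0 /\ u.2 = 0.
    move: uu0; rewrite /dot -!expr2 => /eqP.
    rewrite paddr_eq0 ?sqr_ge0 // !sqrf_eq0 => /andP[/eqP-> /eqP->].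
    by [].
  by rewrite /dot u1 u2 !mulr0 addr0 -ltNge ltr01.
(* After clearing denominators, the two slopes differ by [dot u u * cross (v x) (v y)]. *)
have Xge0 x y : x \in s -> y \in s -> r x y -> 0 <= cross (v x) (v y).
  move=> sx sy; have [_ xu] := Hv x sx; have [_ yu] := Hv y sy.
  rewrite /r /slope ler_pdivrMr; last lra.
  rewrite mulrAC ler_pdivlMr; last lra.
  rewrite -subr_ge0 => h.
  have : 0 <= dot u u * cross (v x) (v y).
    by apply: le_trans h _; rewrite /dot /cross; lra.
  by rewrite pmulr_rge0.
have dle x y : x \in s -> y \in s -> x != y -> dot (v x) (v y) <= 2 + e / 2.
  move=> sx sy nxy; have [/andP[_ xx] _] := Hv x sx.
  have [/andP[_ yy] _] := Hv y sy; have := Hd x y sx sy nxy.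
  have -> : sqdist (v x) (v y) =
      dot (v x) (v x) + dot (v y) (v y) - 2 * dot (v x) (v y).
    by rewrite /sqdist /dot; ring.
  by lra.
have ik : r i k := le_trans ij jk.
have jl : r j l := le_trans jk kl.
have il : r i l := le_trans ij jl.
apply: (@sorted_vectors_contra e B u (v i) (v j) (v k) (v l)) => //;
  try exact: Xge0; try exact: dle.
by move=> _ /[!inE] /or4P[]/eqP->; exact: Hv.
Qed.

End PlaneVectors.

(** * Degenerate graphs and nearly independent sets *)

Lemma degenerate_coloring (I : finType) (q : nat) (S : {set I}) (adj : rel I) :
  symmetric adj ->
  (forall A : {set I}, A \subset S -> A != set0 ->
     exists2 x, x \in A & (#|[set y in A | (y != x) && adj x y]| <= q)%N) ->
  exists f : I -> 'I_q.+1, {in S &, forall x y, x != y -> adj x y -> f x != f y}.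
Proof.
(* Greedy colouring: set aside a vertex with at most [q] neighbours, colour the rest by induction,
   and give the vertex one of the [q.+1] colours that its neighbours leave free. *)
move=> adjC; have [m] := ubnP #|S|; elim: m S => // m IH S Sm degen.
have [-> | S0] := eqVneq S set0.
  by exists (fun=> ord0) => x y; rewrite inE.
have [x xS few] := degen S (subxx _) S0.
have [||f fP] := IH (S :\ x).
- by rewrite (cardsD1 x S) xS add1n ltnS in Sm.
- by move=> A AS; apply: degen; apply: subset_trans AS (subsetDl _ _).
set N := [set y in S | _] in few.
have [c cN] : exists c : 'I_q.+1, c \notin f @: N.
  apply/existsP; rewrite -negb_forall; apply/negP => /forallP full.
  have : (q.+1 <= #|f @: N|)%N.
    rewrite -[X in (X <= _)%N]card_ord; apply/subset_leq_card/subsetP => c _.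
    exact: full.
  by rewrite ltnNge (leq_trans (leq_imset_card _ _)).
exists (fun y => if y == x then c else f y) => y z yS zS yz yzadj.
have fneq t : t \in S -> t != x -> adj x t -> c != f t.
  move=> tS tx xt; apply: contraNneq cN => ->.
  by apply/imsetP; exists t; rewrite // inE tS tx.
case: (eqVneq y x) => [yx | yx]; case: (eqVneq z x) => [zx | zx].
- by rewrite yx zx eqxx in yz.
- by apply: fneq; rewrite // -yx.
- by rewrite eq_sym; apply: fneq; rewrite // -zx adjC.
- by apply: fP; rewrite ?inE ?yx ?zx.
Qed.

Section NearlyIndependent.
Variable R : realFieldType.

(** Let [x] be farthest from [o], and [u] the vector from [x] to [o]. A vector [z] from [x] to
    another point satisfies [dot z z <= 2 * dot z u], because that point is no farther from [o];
    hence [dot z u] is at least [(4 - e) / 2], so at least 1, and [no_four_vectors] applies. *)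
Lemma few_close (I : finType) (A : {set I}) (v : I -> R * R) (o : R * R)
    (e B : R) :
  0 < e -> e <= 2^-1 -> 2 * e * B < 1 ->
  (forall i, i \in A -> sqdist (v i) o <= B) ->
  {in A &, forall i j, i != j -> 4 - e <= sqdist (v i) (v j)} ->
  A != set0 ->
  exists2 x, x \in A
    & (#|[set y in A | (y != x) && (sqdist (v x) (v y) <= 4)%R]| <= 3)%N.
Proof.
move=> e0 e1 eB vB sep /set0Pn[i0 i0A].
case: (Order.TotalTheory.arg_maxP (fun i => sqdist (v i) o) i0A) => x xA xmax.
exists x => //; rewrite cardE.
pose u := (o.1 - (v x).1, o.2 - (v x).2).
pose z i := ((v i).1 - (v x).1, (v i).2 - (v x).2).
apply: (@no_four_vectors _ e B u _ _ z) => //.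
- apply: le_trans (vB x xA); rewrite le_eqVlt; apply/orP; left; apply/eqP.
  by rewrite /dot /sqdist /=; ring.
- exact: enum_uniq.
- move=> i; rewrite mem_enum inE => /and3P[iA ix xi4].
  have zz : dot (z i) (z i) = sqdist (v x) (v i) by rewrite /dot /sqdist /=; ring.
  have := sep x i xA iA; rewrite eq_sym => /(_ ix) xi.
  rewrite zz xi xi4; split=> //.
  have /= : sqdist (v i) o <= sqdist (v x) o := xmax i iA.
  have -> : sqdist (v i) o = sqdist (v x) o + dot (z i) (z i) - 2 * dot (z i) u.
    by rewrite /dot /sqdist /=; ring.
  by rewrite zz; lra.
- move=> i j; rewrite !mem_enum !inE => /andP[iA _] /andP[jA _] ij.
  have -> : sqdist (z i) (z j) = sqdist (v i) (v j).
    by rewrite /sqdist /=; ring.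
  exact: sep.
Qed.

(** Each coordinate difference changes by at most [2 * d]. If the new differences are at most 2, the
    old squared distance exceeds the new one by at most [16 * d + 8 * d ^+ 2], hence by at most
    [24 * d] as [d <= 1]. *)
Lemma sqdist_perturb (p q p' q' : R * R) (d e : R) :
  0 <= d -> 24 * d <= e -> e <= 2^-1 ->
  `|p'.1 - p.1| <= d -> `|p'.2 - p.2| <= d ->
  `|q'.1 - q.1| <= d -> `|q'.2 - q.2| <= d ->
  4 < sqdist p q -> 4 - e <= sqdist p' q'.
Proof.
move=> d0 de e1; have d1 : d <= 1 by lra.
rewrite !ler_norml => /andP[h1 h2] /andP[h3 h4] /andP[h5 h6].
move=> /andP[h7 h8] pq; apply: (@le_trans _ _ (4 - 24 * d)); first lra.
rewrite leNgt; apply/negP => pq'.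
move: pq pq'; rewrite /sqdist.
set x := p'.1 - q'.1; set y := p'.2 - q'.2.
set a := (p'.1 - p.1) - (q'.1 - q.1); set b := (p'.2 - p.2) - (q'.2 - q.2).
have -> : p.1 - q.1 = x - a by rewrite /x /a; ring.
have -> : p.2 - q.2 = y - b by rewrite /y /b; ring.
have ha : `|a| <= 2 * d by rewrite ler_norml /a; apply/andP; split; lra.
have hb : `|b| <= 2 * d by rewrite ler_norml /b; apply/andP; split; lra.
move=> pq pq'.
have hx : `|x| <= 2.
  by rewrite -(ler_pXn2r (n := 2)) ?nnegrE // real_normK ?num_real //; nra.
have hy : `|y| <= 2.
  by rewrite -(ler_pXn2r (n := 2)) ?nnegrE // real_normK ?num_real //; nra.
have hxa : - (x * a) <= 2 * (2 * d).
  by apply: le_trans (ler_norm _) _; rewrite normrN normrM; apply: ler_pM.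
have hyb : - (y * b) <= 2 * (2 * d).
  by apply: le_trans (ler_norm _) _; rewrite normrN normrM; apply: ler_pM.
have haa : a ^+ 2 <= (2 * d) ^+ 2.
  by rewrite -(real_normK (num_real a)); apply: lerXn2r; rewrite ?nnegrE //; lra.
have hbb : b ^+ 2 <= (2 * d) ^+ 2.
  by rewrite -(real_normK (num_real b)); apply: lerXn2r; rewrite ?nnegrE //; lra.
by nra.
Qed.

End NearlyIndependent.

(** * Structured real-RAM programs *)

Inductive test := RLess of nat & nat | WLess of nat & nat.

(* [When s b C] runs [C] iff the test [b] has value [s]; [Loop C] runs [C] until
   word registers 0 and 1 agree. *)
Inductive cmd :=
| Blk of seq instr
| Seq of cmd & cmd
| When of bool & test & cmd
| Loop of cmd.

Definition jump_of (b : test) (l : nat) : instr :=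
  match b with RLess x y => JumpRLt x y l | WLess x y => JumpWLt x y l end.

Fixpoint csize (C : cmd) : nat :=
  match C with
  | Blk s => size s
  | Seq C1 C2 => csize C1 + csize C2
  | When _ _ C1 => (csize C1).+2
  | Loop C1 => (csize C1).+2
  end.

(** Jumps are absolute, so the load address [p] is a parameter. The unconditional jump after the
    test allows both senses [s], although tests only jump when true. *)
Fixpoint compile (p : nat) (C : cmd) : seq instr :=
  match C with
  | Blk s => s
  | Seq C1 C2 => compile p C1 ++ compile (p + csize C1) C2
  | When s b C1 =>
      let body := p.+2 in let exit := (p + (csize C1).+2)%N in
      [:: jump_of b (if s then body else exit),
          Jump (if s then exit else body) & compile p.+2 C1]
  | Loop C1 =>
      JumpWEq 1 0 (p + (csize C1).+2) :: compile p.+1 C1 ++ [:: Jump p]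
  end.

(** A bound on the number of steps when every loop makes [n] iterations. *)
Fixpoint cost (n : nat) (C : cmd) : nat :=
  match C with
  | Blk s => size s
  | Seq C1 C2 => cost n C1 + cost n C2
  | When _ _ C1 => (cost n C1).+2
  | Loop C1 => (n * (cost n C1).+2).+1
  end.

Fixpoint loop_free (C : cmd) : bool :=
  match C with
  | Blk _ => true
  | Seq C1 C2 => loop_free C1 && loop_free C2
  | When _ _ C1 => loop_free C1
  | Loop _ => false
  end.

Fixpoint unnested (C : cmd) : bool :=
  match C with
  | Blk _ => true
  | Seq C1 C2 => unnested C1 && unnested C2
  | When _ _ C1 => unnested C1
  | Loop C1 => loop_free C1
  end.

Definition straight (i : instr) : bool :=
  match i with
  | Jump _ | JumpWEq _ _ _ | JumpWLt _ _ _ | JumpREq _ _ _ | JumpRLt _ _ _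
  | Halt => false
  | _ => true
  end.

Definition seqs (Cs : seq cmd) : cmd := foldr Seq (Blk [::]) Cs.

Definition guards (gs : seq (seq instr * test)) (C : cmd) : cmd :=
  foldr (fun g C' => Seq (Blk g.1) (When true g.2 C')) C gs.

Lemma size_compile p C : size (compile p C) = csize C.
Proof.
elim: C p => //= [C1 IH1 C2 IH2 | _ _ C1 IH | C1 IH] p.
- by rewrite size_cat IH1 IH2.
- by rewrite IH.
- by rewrite size_cat IH addn1.
Qed.

Lemma loop_free_cost n C : loop_free C -> cost n C = cost 0 C.
Proof.
elim: C => //= [C1 IH1 C2 IH2 /andP[f1 f2] | _ _ C1 IH f1].
- by rewrite IH1 ?IH2.
- by rewrite IH.
Qed.

Lemma loop_free_unnested C : loop_free C -> unnested C.
Proof.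
by elim: C => //= C1 IH1 C2 IH2 /andP[f1 f2]; rewrite IH1 ?IH2.
Qed.

(** The body of an unnested loop has a cost independent of [n], so each loop contributes a linear
    term. *)
Lemma unnested_cost C : unnested C ->
  exists k, forall n, (cost n C <= k * n.+1)%N.
Proof.
elim: C => /= [s | C1 IH1 C2 IH2 | _ _ C1 IH | C1 _].
- by exists (size s) => n; rewrite leq_pmulr.
- case/andP=> /IH1[k1 h1] /IH2[k2 h2]; exists (k1 + k2)%N => n.
  by rewrite mulnDl leq_add.
- case/IH=> k h; exists k.+2 => n; have := h n; lia.
- move=> f1; exists (cost 0 C1).+3 => n; rewrite (loop_free_cost n f1); lia.
Qed.

Lemma loop_free_seqs Cs : all loop_free Cs -> loop_free (seqs Cs).
Proof. by elim: Cs => //= C Cs IH /andP[-> /IH]. Qed.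

Lemma unnested_seqs Cs : all unnested Cs -> unnested (seqs Cs).
Proof. by elim: Cs => //= C Cs IH /andP[-> /IH]. Qed.

Lemma loop_free_guards gs C : loop_free C -> loop_free (guards gs C).
Proof. by move=> fC; elim: gs. Qed.

(** * Hoare triples with time bounds *)

Section Triples.
Variables (R : realType) (W : nat).
Implicit Types (c : config R) (P Q : config R -> Prop).

(** Triples treat the [pc] field of their configurations as meaningless; [at_pc] overrides it when
    the machine runs. *)
Definition at_pc (p : nat) c : config R :=
  Config p (wreg c) (rreg c) (wmem c) (rmem c).

Definition teval (b : test) c : bool :=
  match b with
  | RLess x y => rreg c x < rreg c y
  | WLess x y => (wreg c x < wreg c y)%N
  end.

Definition has_code (prog : program) (p : nat) (s : seq instr) : Prop :=
  exists s1 s2, prog = s1 ++ s ++ s2 /\ size s1 = p.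

Lemma has_code_catl prog p s t : has_code prog p (s ++ t) -> has_code prog p s.
Proof. by case=> s1 [s2 [-> <-]]; exists s1, (t ++ s2); rewrite !catA. Qed.

Lemma has_code_catr prog p s t :
  has_code prog p (s ++ t) -> has_code prog (p + size s) t.
Proof.
by case=> s1 [s2 [-> <-]]; exists (s1 ++ s), s2; rewrite size_cat !catA.
Qed.

Lemma has_code_head prog p i s : has_code prog p (i :: s) -> onth prog p = Some i.
Proof.
by case=> s1 [s2 [-> <-]]; rewrite onth_cat ltnn subnn.
Qed.

Lemma has_code_tail prog p i s :
  has_code prog p (i :: s) -> has_code prog p.+1 s.
Proof. by rewrite -cat1s => /has_code_catr; rewrite addn1. Qed.

Lemma run_cat prog t1 t2 c c1 c2 : run W prog t1 c = Some c1 ->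
  run W prog t2 c1 = Some c2 -> run W prog (t1 + t2) c = Some c2.
Proof. by rewrite /run addnC iterD => -> ->. Qed.

Lemma run_cons prog t i p c c1 c2 : onth prog p = Some i ->
  exec W i (at_pc p c) = Some c1 ->
  run W prog t c1 = Some c2 -> run W prog t.+1 (at_pc p c) = Some c2.
Proof.
move=> pi ei; rewrite -add1n; apply: run_cat.
by rewrite /run /= /step /= pi /= ei.
Qed.

Lemma straight_exec i p c c1 : straight i ->
  exec W i c = Some c1 -> exec W i (at_pc p c) = Some (at_pc p.+1 c1).
Proof.
have w_at d v : set_wreg W c d v = Some c1 ->
    set_wreg W (at_pc p c) d v = Some (at_pc p.+1 c1).
  by rewrite /set_wreg; case: ifP => // _ [<-].
case: i => //=; try by move=> *; exact: w_at.
- by move=> d x y _; case: ifP => // _; exact: w_at.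
- by move=> x y _ [<-].
- by move=> d z _ [<-].
- by move=> d x _ [<-].
- by move=> d x _ [<-].
- by move=> d x y _ [<-].
- by move=> d x y _ [<-].
- by move=> d x y _ [<-].
- by move=> d x y _; case: ifP => // _ [<-].
- by move=> d x _ [<-].
- by move=> x y _ [<-].
Qed.

Lemma jump_of_exec b l p c : exec W (jump_of b l) (at_pc p c) =
  Some (at_pc (if teval b c then l else p.+1) c).
Proof. by case: b. Qed.

(** The weakest precondition of straight-line code, including the absence of faults. *)
Fixpoint wp (s : seq instr) Q c : Prop :=
  if s is i :: s' then exists2 c1, exec W i c = Some c1 & wp s' Q c1 else Q c.

Lemma wp_nil Q c : Q c -> wp [::] Q c.
Proof. by []. Qed.

Lemma wp_wreg i s Q c d v : exec W i c = set_wreg W c d v -> (v <= W)%N ->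
  wp s Q (Config (pc c).+1 [eta wreg c with d |-> v] (rreg c) (wmem c) (rmem c))
  -> wp (i :: s) Q c.
Proof. by move=> ei vW h /=; rewrite ei /set_wreg vW; eexists. Qed.

Lemma wp_rreg i s Q c d v : exec W i c = set_rreg c d v ->
  wp s Q (Config (pc c).+1 (wreg c) [eta rreg c with d |-> v] (wmem c) (rmem c))
  -> wp (i :: s) Q c.
Proof. by move=> ei h /=; rewrite ei; eexists. Qed.

(** Total correctness within [cost n C] steps, wherever the code is placed. *)
Definition triple (n : nat) P C Q : Prop := forall prog p c,
  has_code prog p (compile p C) -> P c ->
  exists t c', [/\ (t <= cost n C)%N,
    run W prog t (at_pc p c) = Some (at_pc (p + csize C) c') & Q c'].

Lemma triple_blk n P s Q : all straight s ->
  (forall c, P c -> wp s Q c) -> triple n P (Blk s) Q.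
Proof.
move=> str h prog p c /= code /h {h}.
elim: s p c str code => /= [|i s IH] p c; first by exists 0%N, c; rewrite addn0.
case/andP=> si str code [c1 e1 /(IH p.+1 _ str (has_code_tail code))].
case=> t [c' [tle ht Qc']]; exists t.+1, c'; split=> //.
rewrite addnS -addSn; apply: run_cons (has_code_head code) _ ht.
exact: straight_exec.
Qed.

Lemma triple_seq n P Q S C1 C2 :
  triple n P C1 S -> triple n S C2 Q -> triple n P (Seq C1 C2) Q.
Proof.
move=> h1 h2 prog p c /= code Pc.
have [t1 [c1 [l1 r1 Sc1]]] := h1 prog p c (has_code_catl code) Pc.
have := has_code_catr code; rewrite size_compile => code2.
have [t2 [c2 [l2 r2 Qc2]]] := h2 prog _ c1 code2 Sc1.
exists (t1 + t2)%N, c2; split; rewrite ?leq_add // addnA.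
exact: run_cat r1 r2.
Qed.

Lemma triple_when n P Q s b C :
  triple n (fun c => P c /\ teval b c = s) C Q ->
  (forall c, P c -> teval b c = ~~ s -> Q c) -> triple n P (When s b C) Q.
Proof.
move=> hC hno prog p c /= code Pc.
have code0 := has_code_head code.
have code1 := has_code_head (has_code_tail code).
have code2 := has_code_tail (has_code_tail code).
set l1 := if s then _ else _ in code0; set l2 := if s then _ else _ in code1.
have run1 : exists2 t, (t <= 2)%N & run W prog t (at_pc p c) =
    Some (at_pc (if teval b c == s then p.+2 else p + (csize C).+2) c).
  case bE: (teval b c).
    exists 1%N => //; apply: run_cons code0 (jump_of_exec _ _ _ _) _.
    by rewrite bE /l1; case: (s).
  exists 2%N => //; apply: run_cons code0 (jump_of_exec _ _ _ _) _.
  by rewrite bE; apply: (run_cons (c1 := at_pc l2 c)) code1 _ _;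
    rewrite // /l2; case: (s).
case: run1 => t0 t02; case: eqP => [bs r0 | /eqP nbs r0].
  have [t [c' [tle rt Qc']]] := hC prog _ c code2 (conj Pc bs).
  exists (t0 + t)%N, c'; split=> //; first by move: t02 tle => /=; lia.
  by apply: run_cat r0 _; rewrite -!addSnnS.
exists t0, c; split=> //; first exact: leq_trans t02 _.
by apply: hno => //; move: nbs; case: (s); case: (teval b c).
Qed.

(** The invariant ties the counter to the iteration number, so the loop stops after exactly [n]
    iterations; the body itself has to increment the counter. *)
Lemma triple_loop n C (I : nat -> config R -> Prop) :
  (forall j c, I j c -> wreg c 0%N = n /\ wreg c 1%N = j) ->
  (forall j, (j < n)%N -> triple n (I j) C (I j.+1)) ->
  triple n (I 0%N) (Loop C) (I n).
Proof.
move=> regs body prog p c /= code I0.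
have code0 := has_code_head code.
have code1 := has_code_catl (has_code_tail code).
have := has_code_head (has_code_catr (has_code_tail code)).
rewrite size_compile => code2.
suff loop m j c1 : (j + m = n)%N -> I j c1 -> exists t c',
    [/\ (t <= (m * (cost n C).+2).+1)%N,
        run W prog t (at_pc p c1) = Some (at_pc (p + (csize C).+2) c')
      & I n c'] by exact: (loop n 0%N c).
elim: m j c1 => [|m IH] j c1.
  rewrite addn0 => -> In; exists 1%N, c1; split=> //.
  by apply: run_cons code0 _ _ => //=; have [-> ->] := regs _ _ In; rewrite eqxx.
move=> jm Ij; have jn : (j < n)%N by rewrite -jm -addSnnS leq_addr.
have [t1 [c2 [l1 r1 Ij1]]] := body j jn prog _ c1 code1 Ij.
have [|t2 [c' [l2 r2 In]]] := IH j.+1 c2 _ Ij1; first by rewrite addSnnS.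
exists (t1 + t2.+1).+1, c'; split=> //; first by nia.
apply: run_cons code0 _ _ => //.
rewrite /jump_if /=; have [-> ->] := regs _ _ Ij; rewrite ltn_eqF //.
by apply: run_cat r1 _; apply: run_cons code2 _ r2.
Qed.

(** The invariant is indexed by the elements already processed. *)
Lemma triple_seqs n (A : Type) (f : A -> cmd) (xs : seq A)
    (I : seq A -> config R -> Prop) :
  (forall ys x zs, xs = ys ++ x :: zs ->
     triple n (I ys) (f x) (I (rcons ys x))) ->
  triple n (I [::]) (seqs (map f xs)) (I xs).
Proof.
move=> h; suff gen zs ys : ys ++ zs = xs ->
    triple n (I ys) (seqs (map f zs)) (I xs) by exact: gen.
elim: zs ys => [|x zs IH] ys /=; first by rewrite cats0 => ->; exact: triple_blk.
move=> E; apply: triple_seq (h ys x zs (esym E)) _.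
by apply: IH; rewrite cat_rcons.
Qed.

(** The code preparing each test preserves [P], so at a failed guard [P] still holds and has to
    yield [Q]. *)
Lemma triple_guards n (A : eqType) (f : A -> seq instr * test) (good : pred A)
    (xs : seq A) P Q C :
  (forall x, x \in xs -> all straight (f x).1) ->
  (forall x c, x \in xs -> P c ->
     wp (f x).1 (fun c' => P c' /\ teval (f x).2 c' = good x) c) ->
  (forall c, P c -> ~~ all good xs -> Q c) ->
  triple n (fun c => P c /\ all good xs) C Q ->
  triple n P (guards (map f xs) C) Q.
Proof.
elim: xs => [|x xs IH] str h hno hC /=.
  by move=> prog p c code Pc; exact: hC.
apply: (triple_seq (S := fun c => P c /\ teval (f x).2 c = good x)).
  apply: triple_blk => [|c]; first by apply: str; rewrite mem_head.
  by apply: h; rewrite mem_head.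
case gx: (good x); last first.
  apply: triple_when; first by move=> ? ? c _ [[_ ->]].
  by move=> c [Pc _] _; apply: hno => //=; rewrite gx.
apply: triple_when; last by move=> c [_ ->].
have IH' : triple n P (guards (map f xs) C) Q.
  apply: IH => [y yxs | y c yxs | c Pc nall | prog p c code [Pc ga]].
  - by apply: str; rewrite inE yxs orbT.
  - by apply: h; rewrite inE yxs orbT.
  - by apply: hno => //=; rewrite gx.
  - by apply: hC => //=; rewrite gx.
by move=> prog p c code [[Pc _] _]; exact: IH'.
Qed.

Lemma triple_weaken n P P' Q Q' C : (forall c, P' c -> P c) ->
  (forall c, Q c -> Q' c) -> triple n P C Q -> triple n P' C Q'.
Proof.
move=> hP hQ h prog p c code /hP Pc; have [t [c' [tl r /hQ Qc']]] := h _ _ _ code Pc.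
by exists t, c'.
Qed.

Lemma triple_pure n P (H : Prop) C Q :
  (H -> triple n P C Q) -> triple n (fun c => P c /\ H) C Q.
Proof. by move=> h prog p c code [Pc /h]; apply. Qed.

Lemma triple_exists n (A : Type) (P : A -> config R -> Prop) C Q :
  (forall x, triple n (P x) C Q) -> triple n (fun c => exists x, P x c) C Q.
Proof. by move=> h prog p c code [x]; exact: h. Qed.

Lemma triple_halts n P C Q c T : triple n P C Q -> P c -> pc c = 0%N ->
  (cost n C <= T)%N ->
  exists c', halts_within W (compile 0 C ++ [:: Halt]) T c (at_pc (csize C) c')
             /\ Q c'.
Proof.
move=> h Pc pc0 costT; set prog := _ ++ _.
have code : has_code prog 0 (compile 0 C) by exists [::], [:: Halt].
have [t [c' [tle r Qc']]] := h prog 0%N c code Pc.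
have {1}-> : c = at_pc 0 c by case: c pc0 {Pc r} => ? ? ? ? ? /= ->.
exists c'; split=> //; exists t; split=> //; first exact: leq_trans tle costT.
by rewrite /= /prog onth_cat size_compile ltnn subnn.
Qed.

End Triples.

Arguments wp : simpl never.

(** * The program *)

(* Word registers: 0 holds n, 1 the loop counter, 2 is scratch, 3 to 5 hold the
   constants 1, 3 and 0, and k + 8 holds 1 plus the index of the representative
   of cell k, or 0 if there is none.  While sets of cells are tried, real
   register 7 holds the weight of the best one so far, and word memory already
   marks it. *)
Definition load (x a : nat) : seq instr :=
  [:: WSub 2 a 3; WMul 2 4 2; RLoad x 2; WAdd 2 2 3; RLoad x.+1 2;
      WAdd 2 2 3; RLoad x.+2 2].

(** Real register 5 holds the weight of the current point. An empty cell first receives that point,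
    whose comparison with itself is then harmless. *)
Definition keep_if_heaviest (k : nat) : cmd :=
  Seq (When false (WLess 5 k.+4.+4) (Blk [:: WMove k.+4.+4 1]))
  (Seq (Blk (load 11 k.+4.+4))
       (When false (RLess 5 13) (Blk [:: WMove k.+4.+4 1]))).

(** The counter is incremented first, so that it denotes the current point in the encoding of
    [load]. In the same encoding the constant 1 in word register 3 denotes point 0, the origin of
    the grid. *)
Definition scan_point (m : nat) (ab : int * int) (k : nat) : cmd :=
  Seq (Blk (WAdd 1 1 3 :: load 0 3 ++ load 3 1 ++
    [:: RConst 6 m; RSub 3 3 0; RMul 3 3 6; RSub 4 4 1; RMul 4 4 6;
        RConst 7 ab.1; RConst 8 (ab.1 + 1); RConst 9 ab.2;
        RConst 10 (ab.2 + 1)]))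
  (When false (RLess 3 7) (When false (RLess 8 3)
  (When false (RLess 4 9) (When false (RLess 10 4) (keep_if_heaviest k))))).

Definition scan_cell (m : nat) (cell : nat -> int * int) (k : nat) : cmd :=
  Seq (Blk [:: WConst 1 0]) (Loop (scan_point m (cell k) k)).

Definition nonempty_guard (k : nat) : seq instr * test :=
  ([::], WLess 5 k.+4.+4).

(** Squared distances are compared with 4, as the machine has no square roots. *)
Definition far_guard (kl : nat * nat) : seq instr * test :=
  (load 0 kl.1.+4.+4 ++ load 3 kl.2.+4.+4 ++
     [:: RSub 0 0 3; RSub 1 1 4; RMul 0 0 0; RMul 1 1 1; RAdd 0 0 1;
         RConst 1 4],
   RLess 1 0).

Definition distinct_pairs (T : seq nat) : seq (nat * nat) :=
  [seq kl <- [seq (k, l) | k <- T, l <- T] | kl.1 != kl.2].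

Definition write_cells (v : nat) (T : seq nat) : cmd :=
  seqs [seq Blk [:: WSub 2 k.+4.+4 3; WStore 2 v] | k <- T].

(** Unmarking the representatives of all [K] cells erases the previous set in time independent of
    [n]. A cell without representative then unmarks point 0, which is harmless because marking comes
    afterwards. *)
Definition try_subset (K : nat) (T : seq nat) : cmd :=
  guards (map nonempty_guard T) (guards (map far_guard (distinct_pairs T))
  (Seq (Blk [:: RConst 6 0])
  (Seq (seqs [seq Blk (load 0 k.+4.+4 ++ [:: RAdd 6 6 2]) | k <- T])
  (When true (RLess 7 6)
  (Seq (Blk [:: RMove 7 6]) (Seq (write_cells 5 (iota 0 K)) (write_cells 3 T))))))).

Definition wis_cmd (m K : nat) (cell : nat -> int * int) (Ts : seq (seq nat)) :
    cmd :=
  Seq (Blk [:: WConst 3 1; WConst 4 3])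
  (Seq (seqs [seq scan_cell m cell k | k <- iota 0 K])
  (Seq (Blk [:: RConst 7 0]) (seqs [seq try_subset K T | T <- Ts]))).

Lemma unnested_wis_cmd m K cell Ts : unnested (wis_cmd m K cell Ts).
Proof.
rewrite /= !unnested_seqs //=; last by rewrite all_map; apply/allP => ?.
rewrite all_map; apply/allP => T _ /=.
apply/loop_free_unnested/loop_free_guards/loop_free_guards => /=.
by rewrite !loop_free_seqs // all_map; apply/allP => ?.
Qed.

(** * Correctness of the scan for representatives *)

Section Correctness.
Variables (R : realType) (W n m K : nat) (M : nat -> R).
Variable cell : nat -> int * int.
Implicit Types (c : config R) (T : seq nat).
(** Room for the largest input address [3 * n - 1], and for the constant 3 when [n] is 0. *)
Hypothesis W_large : (3 * n.+1 <= W)%N.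

Definition mem_point (i : nat) : R * R := (M (3 * i)%N, M (3 * i).+1).
Definition mem_weight (i : nat) : R := M (3 * i).+2.

(** Cells are closed, matching negated strict comparisons in the program; a point on a border lies
    in several cells. *)
Definition in_cell (ab : int * int) (i : nat) : bool :=
  let x := ((mem_point i).1 - (mem_point 0).1) * m%:R in
  let y := ((mem_point i).2 - (mem_point 0).2) * m%:R in
  [&& ab.1%:~R <= x <= (ab.1 + 1)%:~R & ab.2%:~R <= y <= (ab.2 + 1)%:~R].

(** The invariant of a cell after the first [t] points have been scanned for it. *)
Definition is_rep (t : nat) (ab : int * int) (r : nat) : Prop :=
  if r is i.+1 then
    [/\ (i < t)%N, in_cell ab i & forall j, (j < t)%N -> in_cell ab j ->
         mem_weight j <= mem_weight i]
  else forall j, (j < t)%N -> ~~ in_cell ab j.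

Definition base c : Prop :=
  [/\ wreg c 0%N = n, wreg c 3%N = 1%N, wreg c 4%N = 3%N, wreg c 5%N = 0%N
    & rmem c = M].

Lemma wp_load x a s Q c : base c -> (wreg c a <= n)%N ->
  (forall c', base c' -> (forall q, q != 2%N -> wreg c' q = wreg c q) ->
     wmem c' = wmem c ->
     rreg c' = [eta [eta [eta rreg c
        with x |-> (mem_point (wreg c a).-1).1]
        with x.+1 |-> (mem_point (wreg c a).-1).2]
        with x.+2 |-> mem_weight (wreg c a).-1] ->
     wp W s Q c') ->
  wp W (load x a ++ s) Q c.
Proof.
case: c => p wr rr wm rm [/= r0 r3 r4 r5 ->] an h /=.
have W2 : ((3 * (wr a).-1).+2 <= W)%N by lia.
apply: wp_wreg; first by []; rewrite /= r3 subn1; first lia.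
apply: wp_wreg; first by []; rewrite /= r4; first lia.
apply: wp_rreg => /=; first by [].
apply: wp_wreg; first by []; rewrite /= r3 addn1; first lia.
apply: wp_rreg => /=; first by [].
apply: wp_wreg; first by []; rewrite /= r3 addn1; first lia.
apply: wp_rreg => /=; first by [].
by apply: h => //= q /negPf ->.
Qed.

Lemma is_rep_skip t ab r : is_rep t ab r -> ~~ in_cell ab t ->
  is_rep t.+1 ab r.
Proof.
move=> + tab; case: r => [|i] /=.
  by move=> h j; rewrite ltnS leq_eqVlt => /predU1P[-> // | /h].
case=> it iab imax; split=> // [|j]; first exact: ltnW.
rewrite ltnS leq_eqVlt => /predU1P[-> | /imax //].
by rewrite (negPf tab).
Qed.

Lemma is_rep_new t ab r : is_rep t ab r -> in_cell ab t ->
  ((0 < r)%N -> mem_weight r.-1 <= mem_weight t) -> is_rep t.+1 ab t.+1.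
Proof.
move=> rab tab le_t; split=> // j; rewrite ltnS leq_eqVlt.
case/predU1P=> [-> // | jt] jab.
case: r rab le_t => [/(_ j jt) | r [_ _ rmax] /(_ isT)]; first by rewrite jab.
exact/le_trans/rmax.
Qed.

Lemma is_rep_old t ab r : (0 < r)%N -> is_rep t ab r ->
  (mem_weight t <= mem_weight r.-1)%R -> is_rep t.+1 ab r.
Proof.
case: r => // r _ [rt rab rmax] le_r; split=> // [|j]; first exact: ltnW.
by rewrite ltnS leq_eqVlt => /predU1P[-> // | /rmax].
Qed.

Lemma is_rep_le t ab r : is_rep t ab r -> (r <= t)%N.
Proof. by case: r => // r []. Qed.

(** Each cell [l] has its own progress [t l], since the points are scanned once per cell. *)
Definition scan_state (t : nat -> nat) (j : nat) c : Prop :=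
  [/\ base c, wmem c = (fun=> 0%N), wreg c 1%N = j
    & forall l, is_rep (t l) (cell l) (wreg c l.+4.+4)].

Section ScanPoint.
Variables (t : nat -> nat) (j k : nat).
Hypotheses (jn : (j < n)%N) (tk : t k = j).

Let post := scan_state [eta t with k |-> j.+1] j.+1.

Let mid (r : nat) c : Prop :=
  [/\ base c, wmem c = (fun=> 0%N), wreg c 1%N = j.+1, rreg c 5 = mem_weight j
    & forall l, if l == k then wreg c l.+4.+4 = r
                else is_rep (t l) (cell l) (wreg c l.+4.+4)].

Let mid_post r c : mid r c -> is_rep j.+1 (cell k) r -> post c.
Proof.
case=> b wm r1 _ reps rk; split=> // l; have := reps l => /=.
by case: eqVneq => [-> -> | ].
Qed.

Lemma triple_keep_if_heaviest r : is_rep j (cell k) r -> in_cell (cell k) j ->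
  triple W n (mid r) (keep_if_heaviest k) post.
Proof.
(* [r'] is the content of the register of cell [k] after the first conditional. *)
move=> rk jk; pose r' := if r == 0%N then j.+1 else r.
have r'n : (r' <= n)%N.
  by rewrite /r'; case: eqP => // _; apply: leq_trans (is_rep_le rk) (ltnW jn).
have set_rep s : triple W n (mid s) (Blk [:: WMove k.+4.+4 1]) (mid j.+1).
  apply: triple_blk => // c [[r0 r3 r4 r5 rm] wm r1 w5 reps].
  apply: wp_wreg; first by [].
    by rewrite r1; lia.
  split=> //= l; rewrite !eqSS; have := reps l; case: eqVneq => // _ _.
apply: (triple_seq (S := mid r')).
  have [r0 | r_gt0] := posnP r.
    have -> : r' = j.+1 by rewrite /r' r0.
    apply: triple_when; first by apply: triple_weaken (set_rep r) => // c [].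
    move=> c [[_ _ _ w5 _] _ _ _ /(_ k)] /=; rewrite eqxx => -> /=.
    by rewrite w5 r0.
  have -> : r' = r by rewrite /r' gtn_eqF.
  apply: triple_when => // prog p c _ [[[_ _ _ w5 _] _ _ _ /(_ k)] /=].
  by rewrite eqxx => ->; rewrite w5 r_gt0.
apply: (triple_seq
  (S := fun c => mid r' c /\ rreg c 13%N = mem_weight r'.-1)).
  apply: triple_blk => // c [b wm r1 w5 reps].
  have repk : wreg c k.+4.+4 = r' by have := reps k; rewrite eqxx.
  rewrite -[load _ _]cats0; apply: wp_load; rewrite ?repk // => c' b' w' wm' rr'.
  split; last by rewrite rr'.
  split=> //; rewrite ?wm' ?w' //; first by rewrite rr'.
  by move=> l; rewrite w' //; exact: reps.
apply: triple_when.
  move=> prog p c code [[midc w13] le_w].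
  have {}le_w : mem_weight r'.-1 <= mem_weight j.
    by case: (midc) le_w => _ _ _ /= -> _; rewrite w13; case: ltP.
  have [t' [c' [tl hr midc']]] := set_rep r' prog p c code midc.
  exists t', c'; split=> //; apply: mid_post midc' _.
  apply: is_rep_new rk jk _ => r_gt0.
  by rewrite /r' gtn_eqF in le_w.
move=> c [midc w13] lt_w; apply: (mid_post midc).
have {lt_w w13} lt_w : mem_weight j < mem_weight r'.-1.
  by case: (midc) lt_w => _ _ _ /= -> _; rewrite w13.
rewrite /r'; have [r0 | r_gt0] := posnP r.
  by apply: is_rep_new rk jk _; rewrite r0.
apply: is_rep_old => //; apply: ltW; move: lt_w.
by rewrite /r' gtn_eqF.
Qed.

Lemma triple_scan_point :
  triple W n (scan_state t j) (scan_point m (cell k) k) post.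
Proof.
move=> prog p c0 code0 st0.
pose r := wreg c0 k.+4.+4.
have rk : is_rep j (cell k) r by have [_ _ _ /(_ k)] := st0; rewrite tk.
suff h : triple W n (fun c => scan_state t j c /\ wreg c k.+4.+4 = r)
    (scan_point m (cell k) k) post by apply: h.
pose x := ((mem_point j).1 - (mem_point 0).1) * m%:R.
pose y := ((mem_point j).2 - (mem_point 0).2) * m%:R.
pose loaded c := [/\ rreg c 3%N = x, rreg c 4%N = y,
  (rreg c 7%N, rreg c 8%N) = ((cell k).1%:~R, ((cell k).1 + 1)%:~R) &
  (rreg c 9%N, rreg c 10%N) = ((cell k).2%:~R, ((cell k).2 + 1)%:~R)].
apply: (triple_seq (S := fun c => mid r c /\ loaded c)).
  apply: triple_blk => // c [[[r0 r3 r4 r5 rm] wm r1 reps] rE].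
  apply: wp_wreg; first by [].
    by rewrite r1 r3; lia.
  set c1 := Config _ _ _ _ _; have b1 : base c1 by [].
  have c1r1 : wreg c1 1%N = j.+1 by rewrite /= r1 r3 addn1.
  have c1r l : wreg c1 l.+4.+4 = wreg c l.+4.+4 by [].
  have c1m : wmem c1 = (fun=> 0%N) by [].
  move: c1 b1 c1r1 c1r c1m => c1 b1 c1r1 c1r c1m.
  have [_ c13 _ _ _] := b1.
  apply: wp_load => //; first by rewrite c13; lia.
  move=> c2 b2 c2r c2m; rewrite c13 => c2v.
  apply: wp_load => //; first by rewrite c2r // c1r1.
  move=> c3 b3 c3r c3m; rewrite c2r // c1r1 c2v => c3v.
  do 9![apply: wp_rreg => /=; first by []]; apply: wp_nil.
  rewrite /mid /loaded /= c3v /=; split; last by [].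
  split=> //=; first by rewrite c3m c2m.
    by rewrite c3r // c2r.
  move=> l; rewrite c3r // c2r // c1r; have := reps l.
  by case: eqVneq => [-> | //]; rewrite rE.
(* Each failed comparison below puts point [j] outside the cell. *)
have skip c : mid r c -> ~~ in_cell (cell k) j -> post c.
  by move=> midc njk; apply: mid_post midc _; exact: is_rep_skip.
apply: triple_when; last first.
  move=> c [midc [/= -> _ [-> _] _]] h.
  by apply: skip midc _; rewrite /in_cell -/x leNgt h.
apply: triple_when; last first.
  move=> c [[midc [/= -> _ [_ ->] _]] _] h.
  by apply: skip midc _; rewrite /in_cell -/x (leNgt x) h andbF.
apply: triple_when; last first.
  move=> c [[[midc [/= _ -> _ [-> _]]] _] _] h.
  by apply: skip midc _; rewrite /in_cell -/y (leNgt _ y) h !andbF.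
apply: triple_when; last first.
  move=> c [[[[midc [/= _ -> _ [_ ->]]] _] _] _] h.
  by apply: skip midc _; rewrite /in_cell -/y (leNgt y) h !andbF.
move=> prog' p' c code [[[[[midc [x3 y4 [a7 a8] [b9 b10]]] /= h1] h2] h3] h4].
apply: (@triple_keep_if_heaviest r rk) => //.
move: h1 h2 h3 h4; rewrite x3 y4 a7 a8 b9 b10 /in_cell -/x -/y.
by rewrite !leNgt => -> -> -> ->.
Qed.

End ScanPoint.

Lemma triple_scan_cell t k : (k < K)%N -> t k = 0%N ->
  triple W n (fun c => exists j, scan_state t j c) (scan_cell m cell k)
    (fun c => exists j, scan_state [eta t with k |-> n] j c).
Proof.
move=> kK tk; apply: (triple_seq (S := scan_state [eta t with k |-> 0%N] 0)).
  apply: triple_blk => // c [j [b wm r1 reps]].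
  apply: wp_wreg => //; split=> //= l; have := reps l.
  by case: eqVneq => // ->; rewrite tk.
apply: (triple_weaken (P := scan_state [eta t with k |-> 0%N] 0)
  (Q := scan_state [eta t with k |-> n] n)) => //; first by move=> c; exists n.
apply: (triple_loop (I := fun j => scan_state [eta t with k |-> j] j)).
  by move=> j c [[]].
move=> j jn.
have := @triple_scan_point [eta t with k |-> j] j k jn.
rewrite /= eqxx => /(_ erefl); apply: triple_weaken => // c.
case=> b wm r1 reps; split=> // l; have := reps l => /=.
by case: eqVneq.
Qed.

Lemma triple_scan_cells :
  triple W n (fun c => exists j, scan_state (fun=> 0%N) j c)
    (seqs [seq scan_cell m cell k | k <- iota 0 K])
    (fun c => exists j, scan_state (fun k => if (k < K)%N then n else 0%N) j c).
Proof.
pose I (ks : seq nat) c :=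
  exists j, scan_state (fun k => if k \in ks then n else 0%N) j c.
have : triple W n (I [::]) (seqs [seq scan_cell m cell k | k <- iota 0 K])
    (I (iota 0 K)).
  apply: triple_seqs => ys k zs E.
  have kK : (k < K)%N.
    by have : k \in iota 0 K by [rewrite E mem_cat mem_head orbT]; rewrite mem_iota.
  have kys : k \notin ys.
    have := iota_uniq 0 K; rewrite E cat_uniq => /and3P[_ /hasPn/(_ k)].
    by rewrite mem_head => /(_ isT).
  pose t l := if l \in ys then n else 0%N.
  have tk : t k = 0%N by rewrite /t (negPf kys).
  apply: triple_weaken (triple_scan_cell kK tk) => // c.
  case=> j [b wm r1 reps]; exists j; split=> // l; have := reps l.
  by rewrite /= mem_rcons inE; case: eqVneq.
apply: triple_weaken => c [j [b wm r1 reps]]; exists j; split=> // l.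
by have := reps l; rewrite mem_iota.
Qed.

(** * Correctness of the search over sets of cells *)

Section Selection.
Variable rep : nat -> nat.
Hypothesis rep_le : forall k, (k < K)%N -> (rep k <= n)%N.

Definition far (kl : nat * nat) : bool :=
  4 < sqdist (mem_point (rep kl.1).-1) (mem_point (rep kl.2).-1).

Definition feasible T : bool :=
  all (fun k => 0 < rep k)%N T && all far (distinct_pairs T).

Definition rep_weight T : R := \sum_(k <- T) mem_weight (rep k).-1.

Definition hits T (a : nat) : bool := has (fun k => (rep k).-1 == a) T.

Definition marked (s : R) (out : pred nat) c : Prop :=
  [/\ base c, forall k, (k < K)%N -> wreg c k.+4.+4 = rep k, rreg c 7%N = s
    & forall a, (wmem c a != 0%N) = out a].

(** The empty list is allowed because the search starts from the empty set, of weight 0. *)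
Definition best Ts c : Prop := exists T,
  [/\ marked (rep_weight T) (hits T) c, T \in [::] :: Ts, feasible T
    & forall T', T' \in Ts -> feasible T' -> rep_weight T' <= rep_weight T].

Lemma wp_load_rep x k s' Q sel out c : (k < K)%N -> marked sel out c ->
  (forall c', base c' -> (forall l, (l < K)%N -> wreg c' l.+4.+4 = rep l) ->
     (forall a, (wmem c' a != 0%N) = out a) ->
     rreg c' = [eta [eta [eta rreg c
        with x |-> (mem_point (rep k).-1).1]
        with x.+1 |-> (mem_point (rep k).-1).2]
        with x.+2 |-> mem_weight (rep k).-1] ->
     wp W s' Q c') ->
  wp W (load x k.+4.+4 ++ s') Q c.
Proof.
move=> kK [b regs r7 wm] h; apply: wp_load; rewrite ?regs ?rep_le //.
move=> c' b' w' wm' rr'; apply: h => // [l lK | a]; last by rewrite wm'.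
by rewrite w' // regs.
Qed.

Lemma triple_write_cells v b T s out : all (gtn K) T -> v != 2%N ->
  (forall c, base c -> (wreg c v != 0%N) = b) ->
  triple W n (marked s out) (write_cells v T)
    (marked s (fun a => if hits T a then b else out a)).
Proof.
move=> TK v2 vb.
apply: (triple_seqs
  (I := fun ys => marked s (fun a => if hits ys a then b else out a))).
move=> ys k zs E; have kK : (k < K)%N.
  by move/allP: TK => /(_ k); rewrite E mem_cat mem_head orbT; apply.
apply: triple_blk => // c [[r0 r3 r4 r5 rm] regs r7 wm].
apply: wp_wreg; first by []; rewrite regs // r3.
  by have := rep_le kK; lia.
set c1 := Config _ _ _ _ _; exists (Config (pc c1).+1 (wreg c1) (rreg c1)
  [eta wmem c1 with wreg c1 2%N |-> wreg c1 v] (rmem c1)) => //.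
apply: wp_nil; split=> // a; rewrite /= subn1 (negPf v2) /hits has_rcons.
rewrite [a == _]eq_sym; case: (_ =P a) => [_ | _] /=; first exact: vb.
by rewrite wm.
Qed.

Lemma triple_try_subset Ts T : all (gtn K) T -> all (all (gtn K)) Ts ->
  triple W n (best Ts) (try_subset K T) (best (rcons Ts T)).
Proof.
move=> TK TsK; apply: triple_exists => T0 prog p c code [mT0 T0Ts fT0 optT0].
have T0K : all (gtn K) T0.
  by move: T0Ts; rewrite inE => /predU1P[-> // | /(allP TsK)].
have kK k : k \in T -> (k < K)%N by move/(allP TK).
pose P := marked (rep_weight T0) (hits T0).
(* This covers all three reasons to reject [T]: an empty cell, two representatives too close, or a
   weight that is not larger. *)
have keep c1 : P c1 -> (feasible T -> rep_weight T <= rep_weight T0) ->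
    best (rcons Ts T) c1.
  move=> Pc1 le_T; exists T0; split=> //.
    by move: T0Ts; rewrite !inE mem_rcons inE => /orP[->|->]; rewrite ?orbT.
  by move=> T'; rewrite mem_rcons inE => /predU1P[-> | /optT0].
suff h : triple W n P (try_subset K T) (best (rcons Ts T)) by exact: h code mT0.
apply: (triple_guards (good := fun k => 0 < rep k)%N) => //.
- move=> k c1 /kK kK' Pc1; apply: wp_nil; split=> //.
  by case: Pc1 => [[_ _ _ r5 _] regs _ _] /=; rewrite r5 regs.
- move=> c1 Pc1 npos; apply: keep => //.
  by rewrite /feasible (negPf npos).
apply: triple_pure => pos.
apply: (triple_guards (good := far)) => //.
- move=> [k l] c1; rewrite mem_filter => /andP[_ /allpairsP[[k' l'] /= ]].
  case=> /kK kK' /kK lK [-> ->] Pc1.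
  have [_ _ r7 _] := Pc1.
  apply: wp_load_rep kK' Pc1 _ => c2 b2 regs2 wm2 rr2.
  have m2 : marked (rep_weight T0) (hits T0) c2 by split=> //; rewrite rr2.
  apply: wp_load_rep lK m2 _ => c3 b3 regs3 wm3; rewrite rr2 => rr3.
  do 6![apply: wp_rreg => /=; first by []]; apply: wp_nil.
  rewrite /P /far /sqdist /= rr3 /=; split; last by rewrite -!expr2.
  by split=> //=; rewrite rr3.
- move=> c1 Pc1 nfar; apply: keep => //.
  by rewrite /feasible (negPf nfar) andbF.
apply: triple_pure => allfar.
have fT : feasible T by rewrite /feasible pos.
apply: (triple_seq (S := fun c1 => P c1 /\ rreg c1 6%N = 0)).
  by apply: triple_blk => // c1 [b1 regs1 r7 wm1]; apply: wp_rreg.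
apply: (triple_seq (S := fun c1 => P c1 /\ rreg c1 6%N = rep_weight T)).
  pose I ys c1 := P c1 /\ rreg c1 6%N = rep_weight ys.
  apply: (@triple_weaken _ _ _ (I [::]) _ (I T)) => //.
    by move=> c1 [Pc1 r6]; split=> //; rewrite r6 /rep_weight big_nil.
  apply: triple_seqs => ys k zs E; apply: triple_blk => // c1 [Pc1 r6].
  have kK' : (k < K)%N by apply: kK; rewrite E mem_cat mem_head orbT.
  have [_ _ r7 _] := Pc1.
  apply: wp_load_rep kK' Pc1 _ => c2 b2 regs2 wm2 rr2.
  apply: wp_rreg => //=; apply: wp_nil; split; first by split=> //=; rewrite rr2.
  by rewrite /= rr2 /= r6 /rep_weight -cats1 big_cat big_seq1.
apply: triple_when; last first.
  move=> c1 [Pc1 r6] /= cmp; apply: keep => // _.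
  by case: Pc1 cmp => _ _ -> _; rewrite r6; case: ltP.
apply: (@triple_weaken _ _ _ (fun c1 => (P c1 /\ rreg c1 6%N = rep_weight T) /\
    (rep_weight T0 < rep_weight T)) _ (best (rcons Ts T))) => //.
  by move=> c1 [[Pc1 r6] /=]; case: (Pc1) => _ _ -> _; rewrite r6.
apply: triple_pure => lt_T.
apply: (triple_seq (S := marked (rep_weight T) (hits T0))).
  by apply: triple_blk => // c1 [[b1 regs1 r7 wm1] r6]; apply: wp_rreg.
apply: (triple_seq (S := marked (rep_weight T) (fun=> false))).
  apply: triple_weaken (@triple_write_cells 5 false (iota 0 K) (rep_weight T)
    (hits T0) _ _ _) => //.
  (* No old mark survives, since every cell of [T0] is among the [K] cells erased. *)
  - move=> c1 [b1 regs1 r7 wm1]; split=> // a; rewrite wm1.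
    case: ifP => // /negbT /hasPn nK; apply/negbTE/hasPn => k kT0.
    by apply: nK; rewrite mem_iota; exact: (allP T0K).
  - by apply/allP => k; rewrite mem_iota.
  - by move=> c1 [_ _ _ ->].
apply: triple_weaken (@triple_write_cells 3 true T (rep_weight T)
  (fun=> false) _ _ _) => //.
- move=> c1 [b1 regs1 r7 wm1]; exists T; split=> //.
  + by split=> // a; rewrite wm1; case: ifP.
  + by rewrite inE mem_rcons inE eqxx orbT.
  move=> T'; rewrite mem_rcons inE => /predU1P[-> // | T'Ts fT'].
  exact: le_trans (optT0 T' T'Ts fT') (ltW lt_T).
- by move=> c1 [_ -> _ _].
Qed.

Lemma triple_try_subsets Ts : all (all (gtn K)) Ts ->
  triple W n (best [::]) (seqs [seq try_subset K T | T <- Ts]) (best Ts).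
Proof.
move=> TsK; apply: triple_seqs => Ts1 T Ts2 E; apply: triple_try_subset.
  by move: TsK; rewrite E all_cat /= => /and3P[].
by move: TsK; rewrite E all_cat => /andP[].
Qed.

End Selection.

Lemma triple_wis_cmd Ts : all (all (gtn K)) Ts ->
  triple W n
    (fun c => [/\ wreg c 0%N = n, forall r, r != 0%N -> wreg c r = 0%N,
                  wmem c = (fun=> 0%N) & rmem c = M])
    (wis_cmd m K cell Ts)
    (fun c => exists rep, (forall k, (k < K)%N -> is_rep n (cell k) (rep k)) /\
              best rep Ts c).
Proof.
move=> TsK.
apply: (triple_seq (S := fun c => exists j, scan_state (fun=> 0%N) j c)).
  apply: triple_blk => // c [r0 rs wm rm].
  do 2![apply: wp_wreg => /=; [by [] | lia | ]]; apply: wp_nil.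
  exists 0%N; split=> //=; first by split=> //=; rewrite rs.
    by rewrite rs.
  by move=> l; rewrite rs.
apply: triple_seq triple_scan_cells _; apply: triple_exists => j.
move=> prog p c code st.
(* The representatives are fixed from here on and read off the registers after the scan. *)
pose rep k := if (k < K)%N then wreg c k.+4.+4 else 0%N.
have repP k : (k < K)%N -> is_rep n (cell k) (rep k).
  by move=> kK; have [_ _ _ /(_ k)] := st; rewrite /rep kK.
have rep_le k : (k < K)%N -> (rep k <= n)%N by move/repP/is_rep_le.
suff h : triple W n (fun c => [/\ base c, wmem c = (fun=> 0%N) &
      forall k, (k < K)%N -> wreg c k.+4.+4 = rep k])
    (Seq (Blk [:: RConst 7 0]) (seqs [seq try_subset K T | T <- Ts]))
    (best rep Ts).
  have [|t [c' [tl r bc']]] := h prog p c code.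
    by case: st => b wm _ _; split=> // k kK; rewrite /rep kK.
  by exists t, c'; split=> //; exists rep.
apply: triple_seq (triple_try_subsets rep_le TsK).
apply: triple_blk => // c1 [b wm regs]; apply: wp_rreg => //; apply: wp_nil.
exists [::]; split=> //.
by split=> //= [| a]; rewrite ?/rep_weight ?big_nil // wm.
Qed.

End Correctness.

(** * The approximation factor *)

Section Geometry.
Variable R : realType.
Implicit Types p q : R * R.

Lemma dist_gt2 p q : (2 < dist p q) = (4 < sqdist p q).
Proof.
have <- : Num.sqrt 4 = 2 :> R.
  by rewrite (_ : 4 = 2 ^+ 2) ?sqrtr_sqr ?ger0_norm //; ring.
by rewrite /dist -/(sqdist p q) !ltNge ler_sqrt.
Qed.

Lemma sqdist_diam (n : nat) (P : 'I_n -> R * R) (D : R) i j :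
  diam P <= D -> sqdist (P i) (P j) <= D ^+ 2.
Proof.
move=> PD; have dD : dist (P i) (P j) <= D.
  apply: le_trans PD; rewrite /diam.
  by apply: le_trans (le_bigmax _ _ i); apply: le_bigmax.
have sq0 : 0 <= sqdist (P i) (P j) by rewrite addr_ge0 ?sqr_ge0.
rewrite -[leLHS]sqr_sqrtr //; apply: lerXn2r => //; rewrite nnegrE.
  exact: sqrtr_ge0.
exact: le_trans (sqrtr_ge0 _) dD.
Qed.

(** The two digits of [k] in base [2 * N + 1], shifted by [N]: the lower left corner of the cell,
    with coordinates from [- N] to [N]. *)
Definition grid_cell (N k : nat) : int * int :=
  ((k %/ N.*2.+1)%:Z - N%:Z, (k %% N.*2.+1)%:Z - N%:Z).

Lemma grid_cell_cover (N : nat) (x y : R) : `|x| <= N%:R -> `|y| <= N%:R ->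
  exists2 k, (k < N.*2.+1 ^ 2)%N &
    ((grid_cell N k).1%:~R <= x <= ((grid_cell N k).1 + 1)%:~R) &&
    ((grid_cell N k).2%:~R <= y <= ((grid_cell N k).2 + 1)%:~R).
Proof.
have index (z : R) : `|z| <= N%:R -> exists2 a : nat, (a < N.*2.+1)%N &
    ((a%:Z - N%:Z)%:~R <= z <= (a%:Z - N%:Z + 1)%:~R).
  rewrite ler_norml => /andP[Nz zN].
  have fl : - N%:Z <= Num.floor z by rewrite floor_ge_int // intrN.
  have fu : Num.floor z <= N%:Z.
    by rewrite -(ler_int R); apply: le_trans (floor_le z) zN.
  exists (absz (Num.floor z + N%:Z)); first lia.
  rewrite gez0_abs; last lia.
  by rewrite addrK floor_le ltW // floorD1_gt.
move=> /index[a aN az] /index[b bN bz].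
exists (a * N.*2.+1 + b)%N; first by rewrite expnS expn1; nia.
by rewrite /grid_cell divnMDl // modnMDl divn_small // modn_small // addn0 az bz.
Qed.

End Geometry.

Lemma mem_point_input (R : realType) (n : nat) (P : 'I_n -> R * R)
    (w : 'I_n -> R) (i : 'I_n) : mem_point (input_rmem P w) i = P i.
Proof.
rewrite /mem_point /input_rmem -[(3 * i).+1]addn1 [(3 * i)%N]mulnC.
by rewrite mulnK // divnMDl // modnMl modnMDl addn0 valK /=; case: (P i).
Qed.

Lemma mem_weight_input (R : realType) (n : nat) (P : 'I_n -> R * R)
    (w : 'I_n -> R) (i : 'I_n) : mem_weight (input_rmem P w) i = w i.
Proof.
rewrite /mem_weight /input_rmem -[(3 * i).+2]addn2.
by rewrite [(3 * i)%N]mulnC divnMDl // modnMDl addn0 valK.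
Qed.

(** * Independence and weight of the marked set *)

Section Selected.
Variables (R : realType) (n : nat) (P : 'I_n -> R * R) (w : 'I_n -> R).
Variables (rep : nat -> nat) (T : seq nat).
Local Notation M := (input_rmem P w).
Hypotheses (rep_in : forall k, k \in T -> (rep k <= n)%N) (uniqT : uniq T).
Hypothesis feasT : feasible M rep T.

Lemma feasible_far k l : k \in T -> l \in T -> k != l ->
  4 < sqdist (mem_point M (rep k).-1) (mem_point M (rep l).-1).
Proof.
move=> kT lT kl; case/andP: feasT => _ /allP/(_ (k, l)); apply.
by rewrite mem_filter kl; apply/allpairsP; exists (k, l).
Qed.

Lemma independent_hits : independent P [set i : 'I_n | hits rep T i].
Proof.
move=> i j; rewrite !inE => /hasP[k kT /eqP ki] /hasP[l lT /eqP lj] ij.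
rewrite dist_gt2 -(mem_point_input P w i) -(mem_point_input P w j) -ki -lj.
apply: feasible_far => //; apply: contraNneq ij => kl.
by apply/eqP/val_inj; rewrite /= -ki -lj kl.
Qed.

(** Representatives of distinct cells of [T] are far apart, hence distinct, so no point is counted
    twice. *)
Lemma weight_hits : weight w [set i : 'I_n | hits rep T i] = rep_weight M rep T.
Proof.
have uniq_rep : uniq [seq (rep k).-1 | k <- T].
  rewrite map_inj_in_uniq // => k l kT lT kl; apply/eqP; apply: contraT => nkl.
  have := feasible_far kT lT nkl.
  by rewrite kl /sqdist !subrr expr0n addr0 ltNge ler0n.
have rep_lt k : k \in T -> ((rep k).-1 < n)%N.
  by move=> kT; case/andP: feasT => /allP/(_ k kT) + _; have := rep_in kT; lia.
rewrite /weight /rep_weight -(big_map (fun k => (rep k).-1) xpredT (mem_weight M)).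
have -> : \sum_(i in [set i : 'I_n | hits rep T i]) w i =
    \sum_(i < n | hits rep T i) mem_weight M i.
  by apply: eq_big => i; rewrite ?inE ?mem_weight_input.
rewrite -(big_mkord (fun i => hits rep T i) (mem_weight M)) -big_filter.
apply: perm_big; apply: uniq_perm => //.
  by rewrite filter_uniq // iota_uniq.
move=> i; rewrite mem_filter mem_index_iota /=.
apply/andP/mapP => [[/hasP[k kT /eqP ki] _] | [k kT ->]].
  by exists k.
by split; [apply/hasP; exists k | exact: rep_lt].
Qed.

End Selected.

(** * The loss of a factor 4 *)

Section Approximation.
Variables (R : realType) (n m K : nat) (cell : nat -> int * int).
Variables (P : 'I_n -> R * R) (w : 'I_n -> R) (D e : R) (rep : nat -> nat).
Local Notation M := (input_rmem P w).
Hypotheses (PD : diam P <= D) (e0 : 0 < e) (e1 : e <= 2^-1).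
Hypotheses (eD : 2 * e * D ^+ 2 < 1) (m0 : (0 < m)%N) (me : 24 <= e * m%:R).
Hypothesis rep_cell : forall k, (k < K)%N -> is_rep m M n (cell k) (rep k).

Lemma in_cell_close ab i j : in_cell m M ab i -> in_cell m M ab j ->
  `|(mem_point M i).1 - (mem_point M j).1| <= m%:R^-1 /\
  `|(mem_point M i).2 - (mem_point M j).2| <= m%:R^-1.
Proof.
have mR : 0 < m%:R :> R by rewrite ltr0n.
have close (a x y z : R) : a <= (x - z) * m%:R <= a + 1 ->
    a <= (y - z) * m%:R <= a + 1 -> `|x - y| <= m%:R^-1.
  move=> hx hy; rewrite -(ler_pM2r mR) mulVf ?gt_eqF //.
  by rewrite -[X in _ * X](ger0_norm (ltW mR)) -normrM ler_norml; lra.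
rewrite /in_cell !intrD => /andP[x1 y1] /andP[x2 y2].
by split; [exact: close x1 x2 | exact: close y1 y2].
Qed.

(** The choice [kappa] is needed as closed cells overlap. Each of the four colour classes is
    compared with [s] through the set of its cells. *)
Lemma weight_le_best (kappa : 'I_n -> 'I_K) (S : {set 'I_n}) (s : R) :
  (forall o, in_cell m M (cell (kappa o)) o) ->
  independent P S ->
  (forall A : {set 'I_K}, feasible M rep (map val (enum A)) ->
     rep_weight M rep (map val (enum A)) <= s) ->
  weight w S <= 4 * s.
Proof.
move=> cellP indS le_s.
have repP o : [/\ (0 < rep (kappa o))%N, ((rep (kappa o)).-1 < n)%N,
    in_cell m M (cell (kappa o)) (rep (kappa o)).-1
    & w o <= mem_weight M (rep (kappa o)).-1].
  have := rep_cell (ltn_ord (kappa o)).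
  case: (rep _) => [/(_ o (ltn_ord o)) | r [rn rc rmax]]; first by rewrite cellP.
  by split=> //=; rewrite -(mem_weight_input P w o); apply: rmax.
pose v o := mem_point M (rep (kappa o)).-1.
have e_lt4 : 0 < 4 - e by have e_le := e1; lra.
have sep : {in S &, forall o o', o != o' -> 4 - e <= sqdist (v o) (v o')}.
  move=> o o' oS o'S oo'; have mR : 0 < m%:R :> R by rewrite ltr0n.
  have [_ _ c1 _] := repP o; have [_ _ c2 _] := repP o'.
  have [h1 h2] := in_cell_close c1 (cellP o).
  have [h3 h4] := in_cell_close c2 (cellP o').
  have far4 := indS o o' oS o'S oo'.
  rewrite dist_gt2 -(mem_point_input P w o) -(mem_point_input P w o') in far4.
  pose d : R := m%:R^-1.
  have d0 : 0 <= d by rewrite invr_ge0 ltW.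
  have d_le : 24 * d <= e by rewrite ler_pdivrMr.
  exact: sqdist_perturb d0 d_le e1 h1 h2 h3 h4 far4.
pose adj o o' := sqdist (v o) (v o') <= 4.
have [||f fP] := @degenerate_coloring _ 3 S adj.
- by move=> o o'; rewrite /adj sqdistC.
- move=> A AS A0; have [o1 o1A] := set0Pn _ A0.
  have n0 : (0 < n)%N by apply: leq_ltn_trans (ltn_ord o1).
  apply: (@few_close _ _ A v (P (Ordinal n0)) e (D ^+ 2)) => //.
    move=> o _; have [_ rn _ _] := repP o.
    by rewrite /v -[X in mem_point M X]/(val (Ordinal rn)) mem_point_input sqdist_diam.
  by move=> o o' oA o'A; apply: sep; exact: (subsetP AS).
pose O c := [set o in S | f o == c].
have class_le c : weight w (O c) <= s.
  have OS o : o \in O c -> o \in S by rewrite inE => /andP[].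
  (* Two points of [S] with the same cell would move to the same representative, at distance 0. *)
  have kappa_inj : {in O c &, injective kappa}.
    move=> o o' oO o'O oo'; apply/eqP; apply: contraT => noo'.
    have := sep o o' (OS o oO) (OS o' o'O) noo'.
    by rewrite /v oo' /sqdist !subrr expr0n addr0 leNgt e_lt4.
  pose A := kappa @: O c.
  (* These cells are feasible: representatives within distance 2 are adjacent, so their points have
     different colours. *)
  apply: le_trans (le_s A _); last first.
    apply/andP; split; apply/allP.
      by move=> _ /mapP[_ /[!mem_enum]/imsetP[o _ ->] ->]; case: (repP o).
    move=> [k l]; rewrite mem_filter /= => /andP[kl /allpairsP[[k' l'] /= []]].
    move=> /mapP[_ /[!mem_enum]/imsetP[o oO ->] ->].
    move=> /mapP[_ /[!mem_enum]/imsetP[o' o'O ->] ->] [ek el].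
    rewrite /far /= ek el; rewrite ek el in kl; rewrite ltNge.
    have noo' : o != o' by apply: contraNneq kl => ->.
    apply: contraTN isT => oo'; have := fP o o' (OS o oO) (OS o' o'O) noo' oo'.
    by move: oO o'O; rewrite !inE => /andP[_ /eqP->] /andP[_ /eqP->]; rewrite eqxx.
  rewrite /rep_weight big_map big_enum /= big_imset //=.
  by apply: ler_sum => o _; case: (repP o).
rewrite {1}/weight (partition_big f predT) //=.
have -> : 4 * s = \sum_(c < 4) s by rewrite sumr_const card_ord mulr_natl.
apply: ler_sum => c _; apply: le_trans (class_le c).
by rewrite le_eqVlt; apply/orP; left; apply/eqP/eq_bigl => o; rewrite inE.
Qed.

End Approximation.

(** * Choice of the constants and assembly *)

Theorem theorem1 (R : realType) (D : R) :
  exists (prog : program) (C : nat),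
    forall (n : nat) (P : 'I_n -> R * R) (w : 'I_n -> R),
      injective P -> diam P <= D ->
      exists c : config R,
        [/\ halts_within (C * n.+1) prog (C * n.+1) (input_config P w) c,
            independent P (output_set n c)
          & forall OPT : {set 'I_n}, max_weight_independent P w OPT ->
              weight w OPT <= 4 * weight w (output_set n c)].
Proof.
(* The summand 1 makes [2 * e * D ^+ 2 < 1] strict and keeps [e] at most [2^-1]. *)
pose e : R := (2 * (D ^+ 2 + 1))^-1.
have D1_gt0 : 0 < D ^+ 2 + 1 by rewrite ltr_wpDl ?sqr_ge0.
have e0 : 0 < e by rewrite invr_gt0 mulr_gt0.
have e1 : e <= 2^-1.
  by rewrite /e lef_pV2 ?posrE ?mulr_gt0 // ler_peMr // lerDr sqr_ge0.
have eD : 2 * e * D ^+ 2 < 1.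
  have -> : 2 * e = (D ^+ 2 + 1)^-1 by rewrite /e invfM mulVKf ?pnatr_eq0.
  by rewrite mulrC ltr_pdivrMr // mul1r ltrDl.
(* The constant 24 comes from [sqdist_perturb] with [d] the cell side [m%:R^-1]. *)
pose m := (Num.truncn (24 / e)).+1.
have me : 24 <= e * m%:R.
  by rewrite mulrC -ler_pdivrMr // ltW // /m truncnS_gt.
(* Scaled coordinates relative to point 0 are at most [D * m] in absolute value, so this grid covers
   all points. *)
pose N := (Num.truncn (`|D| * m%:R)).+1.
have NDm : `|D| * m%:R <= N%:R by rewrite ltW // /N truncnS_gt.
pose K := (N.*2.+1 ^ 2)%N.
(* All sets of cells are spelled out in the program text, whose length depends only on [D]. *)
pose Ts := [seq map val (enum A) | A : {set 'I_K}].
have TsK : all (all (gtn K)) Ts.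
  by apply/allP => _ /imageP[A _ ->]; apply/allP => _ /mapP[k _ ->] /=.
pose Cm := wis_cmd m K (grid_cell N) Ts.
have [C0 costC] := unnested_cost (unnested_wis_cmd m K (grid_cell N) Ts).
(* [C * n.+1] bounds both words and time: 3 is for the addresses, [C0] for the steps. *)
pose C := maxn 3 C0.
exists (compile 0 Cm ++ [:: Halt]), C => n P w _ PD.
pose M := input_rmem P w.
have W_large : (3 * n.+1 <= C * n.+1)%N by rewrite leq_mul2r leq_maxl orbT.
have costW : (cost n Cm <= C * n.+1)%N.
  by apply: leq_trans (costC n) _; rewrite leq_mul2r leq_maxr orbT.
have [||c [haltc [rep [repP [T [markT TTs feasT optT]]]]]] :=
  triple_halts (c := input_config P w)
    (@triple_wis_cmd R (C * n.+1) n m K M (grid_cell N) W_large Ts TsK) _ _ costW.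
- by split=> //= r /negPf ->.
- by [].
exists (at_pc (csize Cm) c).
have {}TTs : exists A : {set 'I_K}, T = map val (enum A).
  move: TTs; rewrite inE => /predU1P[-> | /imageP[A _ ->]]; last by exists A.
  by exists set0; rewrite enum_set0.
have {TTs} [TK uniqT] : (forall k, k \in T -> (k < K)%N) /\ uniq T.
  case: TTs => A ->; rewrite (map_inj_uniq val_inj) enum_uniq.
  by split=> // _ /mapP[k _ ->]; exact: ltn_ord.
have rep_le k : k \in T -> (rep k <= n)%N by move/TK/repP/is_rep_le.
have -> : output_set n (at_pc (csize Cm) c) = [set i : 'I_n | hits rep T i].
  by apply/setP => i; rewrite !inE /=; case: markT => _ _ _ ->.
split=> //; first exact: (independent_hits (w := w)).
move=> OPT [indOPT _]; rewrite (weight_hits rep_le uniqT feasT).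
have cover (o : 'I_n) : exists k : 'I_K, in_cell m M (grid_cell N k) o.
  have n0 : (0 < n)%N by apply: leq_ltn_trans (ltn_ord o).
  have coord (x y : R) : x ^+ 2 + y ^+ 2 <= D ^+ 2 -> `|x * m%:R| <= N%:R.
    move=> xyD; apply: le_trans NDm; rewrite normrM normr_nat.
    rewrite ler_wpM2r // -(ler_pXn2r (n := 2)) ?nnegrE // !real_normK ?num_real //.
    by apply: le_trans xyD; rewrite lerDl sqr_ge0.
  have := sqdist_diam o (Ordinal n0) PD.
  rewrite -(mem_point_input P w o) -(mem_point_input P w (Ordinal n0)) /sqdist.
  move=> xy; have yx := xy; rewrite addrC in yx.
  have [k kK kcell] := grid_cell_cover (coord _ _ xy) (coord _ _ yx).
  by exists (Ordinal kK).
have [kappa kappaP] := fin_all_exists cover.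
apply: (weight_le_best PD e0 e1 eD _ me repP kappaP indOPT) => // A feasA.
by apply: optT => //; apply/imageP; exists A.
Qed.
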